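(* Let $A=(a_{ij})\in\mathbb{R}^{n\times n}$ be an H-matrix, let $\hat A$ be its comparison matrix, and let $\tau>0$ be a drop tolerance. Let $A^{-1}\approx ZDW$ and $\hat A^{-1}\approx \hat Z\hat D\hat W$ be the factored approximate inverses computed by the FFAPINV algorithm (with the same drop tolerance $\tau$) applied to $A$ and $\hat A$ respectively, where $D=\mathrm{diag}(d_1,\ldots,d_n)$ and $\hat D=\mathrm{diag}(\hat d_1,\ldots,\hat d_n)$. Then for every $i=1,\ldots,n$, $$\left|\frac{1}{d_i}\right|\ \ge\ \frac{1}{\hat d_i}\ >\ 0 .$$
   Context: A real square matrix $B=(b_{ij})$ is an M-matrix if $b_{ij}\le 0$ for all $i\ne j$, $B$ is nonsingular, and $B^{-1}\ge 0$ entrywise. The comparison matrix of $A=(a_{ij})$ is $\hat A=(\hat a_{ij})$ with $\hat a_{ii}=|a_{ii}|$ and $\hat a_{ij}=-|a_{ij}|$ for $i\neq j$. $A$ is an H-matrix if $\hat A$ is an M-matrix. FFAPINV algorithm with drop tolerance $\tau$ applied to a matrix $A=(a_{ij})$ of order $n$. Initialize $W=(w_{ij})=I_n$ and $Z=(z_{ij})=I_n$. For $j=1,\ldots,n$ do the following (empty sums are $0$): (1) For $i=j-1,\ldots,1$: set $l_i^{(j)}=a_{ji}+\sum_{k=1}^{i-1}a_{jk}z_{ki}$ and $\beta_i^{(j)}=l_i^{(j)}d_i$; if $|\beta_i^{(j)}|<\tau$, replace $\beta_i^{(j)}$ by $0$. (2) For $i=1,\ldots,j-1$: set $w_{ji}=-\beta_i^{(j)}-\sum_{k=i+1}^{j-1}\beta_k^{(j)}w_{ki}$;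 if $|w_{ji}|<\tau$, replace $w_{ji}$ by $0$. (3) Set $d_j=1/\bigl(a_{jj}+\sum_{k=1}^{j-1}w_{jk}a_{kj}\bigr)$. (4) For $i=j-1,\ldots,1$: set $u_i^{(j)}=a_{ij}+\sum_{k=1}^{i-1}w_{ik}a_{kj}$ and $\alpha_i^{(j)}=u_i^{(j)}d_i$; if $|\alpha_i^{(j)}|<\tau$, replace $\alpha_i^{(j)}$ by $0$. (5) For $i=1,\ldots,j-1$: set $z_{ij}=-\alpha_i^{(j)}-\sum_{k=i+1}^{j-1}\alpha_k^{(j)}z_{ik}$; if $|z_{ij}|<\tau$, replace $z_{ij}$ by $0$. The output is $W$, $Z$, $D=\mathrm{diag}(d_1,\ldots,d_n)$; the notation $A^{-1}\approx ZDW$ just names this output and asserts no quantitative approximation. Here $1/d_j$ denotes the denominator $a_{jj}+\sum_{k=1}^{j-1}w_{jk}a_{kj}$ of step (3). The algorithm breaks down at step $j$ if this denominator is zero. The asserted inequalities are understood to include that no breakdown occurs, for $A$ or for $\hat A$, so that all the quantities are defined. *)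

(* Defs.v *)
From HB Require Import structures.
From mathcomp Require Import all_boot all_order all_algebra.

Set Implicit Arguments.
Unset Strict Implicit.
Unset Printing Implicit Defensive.

Import Order.TTheory GRing.Theory Num.Theory.
Local Open Scope ring_scope.

Definition M_matrix (R : realFieldType) (n : nat) (B : 'M[R]_n) : Prop :=
  [/\ forall i j, i != j -> B i j <= 0,
      B \in unitmx
    & forall i j, 0 <= invmx B i j].

Definition comparison_mx (R : realFieldType) (n : nat) (A : 'M[R]_n) : 'M[R]_n :=
  \matrix_(i, j) if i == j then `|A i j| else - `|A i j|.

Definition H_matrix (R : realFieldType) (n : nat) (A : 'M[R]_n) : Prop :=
  M_matrix (comparison_mx A).

Definition drop_small (R : realFieldType) (tau x : R) : R :=
  if `|x| < tau then 0 else x.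

(* Indices are 0-based. The row vector [ff_d s] holds the diagonal of D; its
   entries that have not been computed yet are 0 and are never read. *)
Record ff_state (R : realFieldType) (n : nat) := FFState {
  ff_W : 'M[R]_n;
  ff_Z : 'M[R]_n;
  ff_d : 'rV[R]_n
}.

Section FFAPINV.

Variables (R : realFieldType) (n : nat) (tau : R) (A : 'M[R]_n).
Implicit Types (W Z : 'M[R]_n) (d : 'rV[R]_n) (i j k : 'I_n).

(* In a given step j, no beta_i depends on another beta_i, and the w_ji that are
   computed only use rows k < j of W; likewise for alpha and the columns of Z.
   Hence each inner loop is written as a simultaneous assignment. *)

Definition ff_beta Z d j i : R :=
  drop_small tau ((A j i + \sum_(k < n | (k < i)%N) A j k * Z k i) * d 0 i).

Definition ff_updW W Z d j : 'M[R]_n :=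
  \matrix_(r, i)
    if (r == j) && (i < j)%N then
      drop_small tau (- ff_beta Z d j i
                      - \sum_(k < n | (i < k < j)%N) ff_beta Z d j k * W k i)
    else W r i.

Definition ff_pivot W j : R := A j j + \sum_(k < n | (k < j)%N) W j k * A k j.

Definition ff_updd d j (x : R) : 'rV[R]_n :=
  \row_i if i == j then x else d 0 i.

Definition ff_alpha W d j i : R :=
  drop_small tau ((A i j + \sum_(k < n | (k < i)%N) W i k * A k j) * d 0 i).

Definition ff_updZ W Z d j : 'M[R]_n :=
  \matrix_(i, c)
    if (c == j) && (i < j)%N then
      drop_small tau (- ff_alpha W d j i
                      - \sum_(k < n | (i < k < j)%N) ff_alpha W d j k * Z i k)
    else Z i c.

(* [None] signals a breakdown. *)
Definition ff_step (s : ff_state R n) j : option (ff_state R n) :=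
  let W := ff_updW (ff_W s) (ff_Z s) (ff_d s) j in
  let p := ff_pivot W j in
  if p == 0 then None
  else let d := ff_updd (ff_d s) j p^-1 in
       let Z := ff_updZ W (ff_Z s) d j in
       Some (FFState W Z d).

Definition ffapinv : option (ff_state R n) :=
  foldl (fun os j => obind (fun s => ff_step s j) os)
        (Some (FFState 1%:M 1%:M 0)) (enum 'I_n).

End FFAPINV.

(* Main.v *)
(* The comparison matrix, being an M-matrix, has an exact factorization L D U
   with L, U unit triangular with nonpositive off-diagonal entries and D > 0.
   By induction on the steps, every entry of W and Z computed for A is bounded
   in absolute value by its counterpart for the comparison matrix (dropping is
   monotone in the absolute value), which in turn is at most the entry of
   P = L^-1, resp. Q = U^-1, since dropping only decreases nonnegative entries.
   The pivots decrease in W, so D_j <= 1/dhat_j <= |1/d_j|. *)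

Require Import Defs.
From mathcomp Require Import all_boot all_order all_algebra.
From mathcomp Require Import reals.
From mathcomp Require Import lra.

Set Implicit Arguments.
Unset Strict Implicit.
Unset Printing Implicit Defensive.

Import Order.TTheory GRing.Theory Num.Theory.
Local Open Scope ring_scope.

(** * Unit triangular factors and the LDU factorization of an M-matrix *)

Definition unit_lower (R : realFieldType) (n : nat) (L : 'M[R]_n) : Prop :=
  forall i j : 'I_n, (i <= j)%N -> L i j = (i == j)%:R.

(** [P] is carried along as the explicit inverse of [L]. Upper factors [U], [Q] enter through their
    transposes, so one predicate serves both sides. *)
Definition lower_Zfactor (R : realFieldType) (n : nat) (L P : 'M[R]_n) : Prop :=
  [/\ unit_lower L, unit_lower P, L *m P = 1%:M
    & forall i j, i != j -> L i j <= 0].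

(** Block inversion: bordering [L] by a unit pivot with column [l] below it borders the inverse by
    the column [- (P *m l)]. *)
Lemma lower_Zfactor_block (R : realFieldType) (n : nat) (l : 'cV[R]_n)
    (L P : 'M[R]_n) :
  (forall i, l i 0 <= 0) -> lower_Zfactor L P ->
  lower_Zfactor (block_mx 1%:M 0 l L : 'M_(1 + n))
                (block_mx 1%:M 0 (- (P *m l)) P : 'M_(1 + n)).
Proof.
have ulb (c : 'cV[R]_n) (M : 'M[R]_n) : unit_lower M ->
    unit_lower (block_mx 1%:M 0 c M : 'M_(1 + n)).
  move=> hM i j.
  case: (split_ordP i) => i' ->; case: (split_ordP j) => j' -> /=.
  - by rewrite block_mxEul !ord1 mxE eqxx.
  - by rewrite block_mxEur mxE eq_lrshift.
  - by rewrite ord1.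
  - by rewrite block_mxEdr eq_rshift leq_add2l => /hM.
move=> l0 [uL uP LP L0]; split; [exact: ulb | exact: ulb | |].
  rewrite mulmx_block !mul1mx !mul0mx !mulmx0 mulmx1 !addr0 add0r LP.
  by rewrite mulmxN mulmxA LP mul1mx subrr -scalar_mx_block.
move=> i j.
case: (split_ordP i) => i' ->; case: (split_ordP j) => j' -> /=.
- by rewrite !ord1 eqxx.
- by rewrite block_mxEur mxE.
- by rewrite block_mxEdl ord1.
- by rewrite block_mxEdr eq_rshift => /L0.
Qed.

(* Eliminating the first variable leaves a Schur complement that is again a
   Z-matrix and maps the tail of x to a positive vector. *)
Lemma Zmatrix_LDU (R : realFieldType) (n : nat) (A : 'M[R]_n) (x : 'cV[R]_n) :
  (forall i j, i != j -> A i j <= 0) ->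
  (forall i, 0 < x i 0) -> (forall i, 0 < (A *m x) i 0) ->
  exists (L P U Q : 'M[R]_n) (D : 'rV[R]_n),
    [/\ lower_Zfactor L P, lower_Zfactor U^T Q^T, forall i, 0 < D 0 i
      & A = L *m diag_mx D *m U].
Proof.
elim: n A x => [|n IHn] A x A0 x0 Ax0.
  exists 1%:M, 1%:M, 1%:M, 1%:M, 0.
  by split; [split=> [[]|[]||[]] | split=> [[]|[]||[]] | case | ] => //;
     apply/matrixP=> [[]].
rewrite -[n.+1]/(1 + n)%N in A x A0 x0 Ax0 *.
pose a := ulsubmx A 0 0; pose u := ursubmx A; pose l := dlsubmx A.
pose B := drsubmx A; pose xt := dsubmx x; pose xh := usubmx x 0 0.
have u0 j : u 0 j <= 0 by rewrite /u !mxE; apply: A0; rewrite eq_lrshift.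
have l0 i : l i 0 <= 0 by rewrite /l !mxE; apply: A0; rewrite eq_rlshift.
have xt0 i : 0 < xt i 0 by rewrite /xt mxE.
have xh0 : 0 < xh by rewrite /xh mxE.
have EA : A = block_mx a%:M u l B by rewrite /a -mx11_scalar submxK.
have Ex : x = col_mx xh%:M xt by rewrite /xh -mx11_scalar vsubmxK.
have EAx : A *m x = col_mx (a%:M *m xh%:M + u *m xt) (l *m xh%:M + B *m xt).
  by rewrite EA Ex mul_block_col.
have h1 : 0 < a * xh + (u *m xt) 0 0.
  have := Ax0 (lshift n 0).
  by rewrite EAx col_mxEu -scalar_mxM mxE [_%:M 0 0]mxE eqxx mulr1n.
have h2 i : 0 < l i 0 * xh + (B *m xt) i 0.
  have := Ax0 (rshift 1 i).
  by rewrite EAx col_mxEd mul_mx_scalar mxE [X in X + _]mxE mulrC.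
have ux0 : (u *m xt) 0 0 <= 0.
  by rewrite mxE; apply: sumr_le0 => k _; rewrite mulr_le0_ge0 // ltW.
(* The first row of [A *m x] gives [a * xh > - (u *m xt) 0 0 >= 0]. *)
have a0 : 0 < a by rewrite -(pmulr_lgt0 _ xh0); lra.
have ai0 : 0 < a^-1 by rewrite invr_gt0.
pose S := B - a^-1 *: (l *m u).
have [| |L [P [U [Q [D [hL hU D0 ES]]]]]] := IHn S xt _ xt0.
- move=> i j ij; rewrite !mxE big_ord1.
  have : B i j <= 0 by rewrite /B !mxE; apply: A0; rewrite eq_rshift.
  have : 0 <= a^-1 * (l i 0 * u 0 j).
    by rewrite mulr_ge0 ?mulr_le0 // ltW.
  rewrite /B !mxE; lra.
(* Dividing [h1] by [a] gives [- c / a <= xh]; as [l i 0 <= 0], the positive [l i 0 * xh + b] is at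
   most [b - a^-1 * (l i 0 * c)]. *)
- move=> i; rewrite mulmxBl -scalemxAl -mulmxA.
  rewrite mxE [X in _ + X]mxE [X in - X]mxE [X in _ * X]mxE big_ord1; move: (h2 i) h1.
  set b := (B *m xt) i 0; set c := (u *m xt) 0 0 => hb hc.
  apply: lt_le_trans hb _; rewrite [leRHS]addrC lerD2r.
  rewrite mulrCA -mulrN ler_wnM2l // -mulrN mulrC ler_pdivrMr //; lra.
have al0 (v : 'cV[R]_n) : (forall i, v i 0 <= 0) ->
    forall i, (a^-1 *: v) i 0 <= 0.
  by move=> v0 i; rewrite mxE mulr_ge0_le0 // ltW.
exists (block_mx 1%:M 0 (a^-1 *: l) L), (block_mx 1%:M 0 (- (P *m (a^-1 *: l))) P).
exists (block_mx 1%:M (a^-1 *: u) 0 U).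
exists (block_mx 1%:M 0 (- (Q^T *m (a^-1 *: u^T))) Q^T)^T.
exists (row_mx a%:M D); split.
- exact: lower_Zfactor_block (al0 _ l0) hL.
- rewrite trmxK tr_block_mx trmx1 trmx0 linearZ /=.
  by apply: lower_Zfactor_block hU; apply: al0 => i; rewrite mxE.
- move=> i; case: (split_ordP i) => i' ->; last by rewrite row_mxEr.
  by rewrite row_mxEl ord1 mxE.
- rewrite diag_mx_row !mulmx_block !mul1mx !mulmx0 !mul0mx !mulmx1 !addr0 !add0r.
  have -> : diag_mx (a%:M : 'M_1) = a%:M.
    by apply/matrixP=> i j; rewrite !ord1 !mxE eqxx.
  rewrite mul_scalar_mx mul_mx_scalar !scalerA divff ?gt_eqF // !scale1r -ES.
  by rewrite -scalemxAr /S [_ *: _ + _]addrC subrK mul0mx addr0 -EA.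
Qed.

(** Take for [x] the inverse applied to the all-ones vector: [B *m x] is then all ones, and the
    entries of [x] are row sums of a nonnegative matrix. *)
Lemma M_matrix_LDU (R : realFieldType) (n : nat) (B : 'M[R]_n) :
  M_matrix B ->
  exists (L P U Q : 'M[R]_n) (D : 'rV[R]_n),
    [/\ lower_Zfactor L P, lower_Zfactor U^T Q^T, forall i, 0 < D 0 i
      & B = L *m diag_mx D *m U].
Proof.
move=> [B0 uB iB0]; pose e : 'cV[R]_n := const_mx 1.
apply: (@Zmatrix_LDU R n B (invmx B *m e)) => // i; last first.
  by rewrite mulKVmx // mxE ltr01.
rewrite lt_neqAle mxE andbC sumr_ge0 /=; last first.
  by move=> k _; rewrite mulr_ge0 // mxE ler01.
(* A zero row sum would make row [i] of the inverse vanish, against the diagonal entry of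
   [invmx B *m B = 1%:M]. *)
apply/negP => /eqP /esym /eqP; rewrite psumr_eq0; last first.
  by move=> k _; rewrite mulr_ge0 // mxE ler01.
move/allP => r0.
have := congr1 (fun M : 'M_n => M i i) (mulVmx uB).
rewrite !mxE eqxx big1 => [/eqP|k _]; first by rewrite eq_sym oner_eq0.
by have := r0 k (mem_index_enum _); rewrite [e _ _]mxE mulr1 => /eqP ->; rewrite mul0r.
Qed.

Lemma unit_lower_mulr (R : realFieldType) (n : nat) (M P : 'M[R]_n) (j i : 'I_n) :
  unit_lower P ->
  (P *m M) j i = M j i + \sum_(k < n | (k < j)%N) P j k * M k i.
Proof.
move=> uP; rewrite mxE (bigD1 j) //= uP // eqxx mul1r; congr (_ + _).
rewrite big_mkcond [RHS]big_mkcond; apply: eq_bigr => k _.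
case: (ltngtP k j) => [h|h|/val_inj ->]; last by rewrite eqxx.
  by rewrite -val_eqE ltn_eqF.
by rewrite uP 1?ltnW // -!val_eqE gtn_eqF // ltn_eqF // mul0r.
Qed.

(** Entry [(j, i)] of [L *m P = 1%:M], solved for [P j i]. This is the recursion for row [j] of [W]
    without dropping, with [L j k] in place of the multipliers [beta]. *)
Lemma lower_Zfactor_rec (R : realFieldType) (n : nat) (L P : 'M[R]_n) (i j : 'I_n) :
  lower_Zfactor L P -> (i < j)%N ->
  P j i = - L j i - \sum_(k < n | (i < k < j)%N) L j k * P k i.
Proof.
move=> [uL uP LP _] ij.
have := congr1 (fun M : 'M_n => M j i) LP.
rewrite unit_lower_mulr // (bigD1 i) //= (uP i i) // eqxx mulr1 mxE -val_eqE gtn_eqF //=.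
rewrite (_ : \sum_(k < n | _) _ = \sum_(k < n | (i < k < j)%N) L j k * P k i).
  by move=> h; lra.
rewrite big_mkcond [RHS]big_mkcond; apply: eq_bigr => k _.
case: (ltngtP k i) => [h|h|/val_inj ->] /=; last by rewrite eqxx andbF.
  by rewrite (uP _ _ (ltnW h)) -val_eqE ltn_eqF //= mulr0 if_same.
by rewrite -val_eqE gtn_eqF //= andbT.
Qed.

(** Both sides are entry [(j, i)] of [B *m Q = L *m diag_mx D]. Hence the undropped multipliers
    [beta] are the entries of [L]. *)
Lemma LDU_column (R : realFieldType) (n : nat) (B L U Q : 'M[R]_n) (D : 'rV[R]_n)
    (i j : 'I_n) :
  lower_Zfactor U^T Q^T -> B = L *m diag_mx D *m U ->
  B j i + \sum_(k < n | (k < i)%N) B j k * Q k i = L j i * D 0 i.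
Proof.
move=> [_ uQ UQ _] EB.
have /mulmx1C QU : Q *m U = 1%:M.
  by rewrite -[Q]trmxK -[U]trmxK -trmx_mul UQ trmx1.
have -> : L j i * D 0 i = (B *m Q) j i.
  rewrite EB -!mulmxA QU mulmx1 mxE (bigD1 i) //= !mxE eqxx big1 ?addr0 //.
  by move=> k ki; rewrite mxE (negPf ki) mulr0.
have -> : (B *m Q) j i = (B *m Q)^T i j by rewrite [RHS]mxE.
rewrite trmx_mul unit_lower_mulr //.
by rewrite mxE; congr (_ + _); apply: eq_bigr => k _; rewrite !mxE mulrC.
Qed.

(** [P *m B = diag_mx D *m U] has diagonal [D]: the exact [P] yields the exact pivots. *)
Lemma LDU_pivot (R : realFieldType) (n : nat) (B L P U Q : 'M[R]_n) (D : 'rV[R]_n)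
    (j : 'I_n) :
  lower_Zfactor L P -> lower_Zfactor U^T Q^T -> B = L *m diag_mx D *m U ->
  ff_pivot B P j = D 0 j.
Proof.
move=> [_ uP LP _] [uU _ _ _] EB.
rewrite /ff_pivot -unit_lower_mulr // EB -!mulmxA mulmxA (mulmx1C LP) mul1mx.
have := uU j j (leqnn _); rewrite mxE eqxx => Ujj.
by rewrite mul_diag_mx mxE Ujj mulr1.
Qed.

Lemma LDU_tr (R : realFieldType) (n : nat) (B L U : 'M[R]_n) (D : 'rV[R]_n) :
  B = L *m diag_mx D *m U -> B^T = U^T *m diag_mx D *m L^T.
Proof. by move=> ->; rewrite !trmx_mul tr_diag_mx mulmxA. Qed.

(** * The chain [|x| <= y <= z] under dropping, sums and products *)

Lemma drop_smallN (R : realFieldType) (tau x : R) :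
  drop_small tau (- x) = - drop_small tau x.
Proof. by rewrite /drop_small normrN; case: ifP; rewrite ?oppr0. Qed.

(** If [y < tau], both [x] and [y] are dropped; otherwise [y] stays and [x] can only shrink. *)
Lemma drop_small_le (R : realFieldType) (tau x y z : R) :
  `|x| <= y <= z -> `|drop_small tau x| <= drop_small tau y <= z.
Proof.
move=> /andP[xy yz]; have y0 := le_trans (normr_ge0 x) xy.
rewrite /drop_small (ger0_norm y0).
case: (ltrP y tau) => yt; first by rewrite (le_lt_trans xy yt) normr0 lexx (le_trans y0).
by rewrite yz andbT; case: ifP; rewrite ?normr0.
Qed.

Lemma norm_le_add (R : realFieldType) (x1 y1 z1 x2 y2 z2 : R) :
  `|x1| <= y1 <= z1 -> `|x2| <= y2 <= z2 -> `|x1 + x2| <= y1 + y2 <= z1 + z2.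
Proof.
move=> /andP[h1 k1] /andP[h2 k2]; rewrite lerD // andbT.
exact: le_trans (ler_normD _ _) (lerD _ _).
Qed.

(** The chain itself forces [y] and [z] to be nonnegative, so products are monotone. *)
Lemma norm_le_mul (R : realFieldType) (x1 y1 z1 x2 y2 z2 : R) :
  `|x1| <= y1 <= z1 -> `|x2| <= y2 <= z2 -> `|x1 * x2| <= y1 * y2 <= z1 * z2.
Proof.
move=> /andP[h1 k1] /andP[h2 k2]; rewrite normrM.
by rewrite !ler_pM // ?(le_trans _ h1) ?(le_trans _ h2).
Qed.

Lemma norm_le_sum (R : realFieldType) (I : finType) (p : pred I) (f g h : I -> R) :
  (forall i, p i -> `|f i| <= g i <= h i) ->
  `|\sum_(i | p i) f i| <= \sum_(i | p i) g i <= \sum_(i | p i) h i.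
Proof.
move=> H; rewrite (le_trans (ler_norm_sum _ _ _)) /=.
  by apply: ler_sum => i /H /andP[].
by apply: ler_sum => i /H /andP[].
Qed.

(** * Step-by-step comparison of the runs on [A] and on [comparison_mx A] *)

Section Comparison.

Context {R : realFieldType} {n : nat} (tau : R).
Implicit Types (A L P U Q W What Z Zhat : 'M[R]_n) (d dhat D : 'rV[R]_n)
  (i j k : 'I_n) (m : nat).

(** [m] counts the completed steps: the first [m] rows are those already computed. The matrices [Z]
    enter transposed. *)
Definition lower_bounded W What P m : Prop :=
  forall r i : 'I_n, (i < r < m)%N -> `|W r i| <= What r i <= P r i.

Definition diag_bounded d dhat D m : Prop :=
  forall i : 'I_n, (i < m)%N ->
    D 0 i <= (dhat 0 i)^-1 /\ (dhat 0 i)^-1 <= `|(d 0 i)^-1|.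

(** The multipliers for the comparison matrix are nonpositive, hence the signs. Their undropped
    counterpart is [L j i], by [LDU_column]. *)
Lemma ff_beta_bounded A L P U Q D Z Zhat d dhat j i :
  lower_Zfactor L P -> lower_Zfactor U^T Q^T -> (forall k, 0 < D 0 k) ->
  comparison_mx A = L *m diag_mx D *m U ->
  lower_bounded Z^T Zhat^T Q^T j -> diag_bounded d dhat D j -> (i < j)%N ->
  `|ff_beta tau A Z d j i| <= - ff_beta tau (comparison_mx A) Zhat dhat j i
    <= - L j i.
Proof.
move=> hL hU D0 E hZ hd ij; rewrite /ff_beta -drop_smallN; apply: drop_small_le.
have [Dd dd] := hd i ij; have d0 := lt_le_trans (D0 i) Dd.
have nA (k : 'I_n) : (k < j)%N -> `|A j k| <= - comparison_mx A j k
    <= - comparison_mx A j k.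
  by move=> kj; rewrite mxE -val_eqE gtn_eqF //= opprK !lexx.
(* Inversion of positive numbers turns [D <= 1 / dhat <= |1 / d|] into [|d| <= dhat <= 1 / D]. *)
have h1 : `|d 0 i| <= dhat 0 i <= (D 0 i)^-1.
  rewrite -[X in _ && (X <= _)]invrK lef_pV2 ?posrE // Dd andbT.
  by rewrite -[dhat 0 i]invrK -[d 0 i]invrK normfV lef_pV2 ?posrE // (lt_le_trans d0 dd).
rewrite -mulNr -[L j i](mulfK (lt0r_neq0 (D0 i))) -mulNr -(LDU_column _ _ hU E).
apply: norm_le_mul h1; rewrite !opprD -!sumrN; apply: norm_le_add; first exact: nA.
apply: norm_le_sum => k ki; rewrite -!mulNr; apply: norm_le_mul.
  exact/nA/(ltn_trans ki).
by have := hZ i k; rewrite !mxE ki ij; apply.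
Qed.

(** Row [j] is compared term by term with the recursion [lower_Zfactor_rec]; earlier rows are
    unchanged. *)
Lemma ff_updW_bounded A L P U Q D W What Z Zhat d dhat j :
  lower_Zfactor L P -> lower_Zfactor U^T Q^T -> (forall k, 0 < D 0 k) ->
  comparison_mx A = L *m diag_mx D *m U ->
  lower_bounded W What P j -> lower_bounded Z^T Zhat^T Q^T j ->
  diag_bounded d dhat D j ->
  lower_bounded (ff_updW tau A W Z d j)
    (ff_updW tau (comparison_mx A) What Zhat dhat j) P j.+1.
Proof.
move=> hL hU D0 E hW hZ hd r i /andP[ir]; rewrite ltnS leq_eqVlt.
have hb k := ff_beta_bounded (i := k) hL hU D0 E hZ hd.
case/predU1P => [/val_inj ?|rj]; last first.
  by rewrite !mxE -val_eqE ltn_eqF //=; apply: hW; rewrite ir.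
subst r; rewrite !mxE eqxx ir /=; apply: drop_small_le.
rewrite (lower_Zfactor_rec hL ir); apply: norm_le_add.
  by rewrite normrN hb.
rewrite -!sumrN; apply: norm_le_sum => k /andP[ik kj].
rewrite -!mulNr; apply: norm_le_mul; first by rewrite normrN hb.
by apply: hW; rewrite ik.
Qed.

Lemma comparison_mx_tr A : comparison_mx A^T = (comparison_mx A)^T.
Proof. by apply/matrixP => i j; rewrite !mxE eq_sym. Qed.

(** Transposition exchanges the two halves of a step, so the bounds for [W] carry over to [Z]. *)
Lemma ff_updZ_tr A W Z d j :
  (ff_updZ tau A W Z d j)^T = ff_updW tau A^T Z^T W^T d j.
Proof.
have ab i : ff_alpha tau A W d j i = ff_beta tau A^T W^T d j i.
  congr (drop_small tau (_ * _)); rewrite !mxE; congr (_ + _).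
  by apply: eq_bigr => k _; rewrite !mxE mulrC.
apply/matrixP => r i; rewrite !mxE ab.
case: ifP => // _; congr (drop_small tau (_ - _)).
by apply: eq_bigr => k _; rewrite ab mxE.
Qed.

(** The pivot for the comparison matrix is [|A j j|] minus a sum increasing in [What]. Enlarging
    [What] to [P] lowers it to [D 0 j]; the reverse triangle inequality gives the upper bound. *)
Lemma ff_pivot_bounded A L P U Q D W What j :
  lower_Zfactor L P -> lower_Zfactor U^T Q^T ->
  comparison_mx A = L *m diag_mx D *m U -> lower_bounded W What P j.+1 ->
  D 0 j <= ff_pivot (comparison_mx A) What j <= `|ff_pivot A W j|.
Proof.
move=> hL hU E hW.
have nA (k : 'I_n) : (k < j)%N -> comparison_mx A k j = - `|A k j|.
  by move=> kj; rewrite mxE -val_eqE ltn_eqF.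
have hS : `|\sum_(k < n | (k < j)%N) W j k * A k j|
    <= \sum_(k < n | (k < j)%N) What j k * `|A k j|
    <= \sum_(k < n | (k < j)%N) P j k * `|A k j|.
  apply: norm_le_sum => k kj; apply: norm_le_mul; last by rewrite !lexx.
  by apply: hW; rewrite kj ltnS leqnn.
have eS (V : 'M[R]_n) : ff_pivot (comparison_mx A) V j
    = `|A j j| - \sum_(k < n | (k < j)%N) V j k * `|A k j|.
  rewrite /ff_pivot mxE eqxx -sumrN; congr (_ + _).
  by apply: eq_bigr => k kj; rewrite nA // mulrN.
rewrite -(LDU_pivot _ hL hU E) !eS.
case/andP: hS => h1 h2; rewrite lerD2l lerN2 h2 /=.
by apply: le_trans (lerB_normD _ _); rewrite lerD2l lerN2.
Qed.

Definition ff_bounded P Q D m (s shat : ff_state R n) : Prop :=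
  [/\ lower_bounded (ff_W s) (ff_W shat) P m,
      lower_bounded (ff_Z s)^T (ff_Z shat)^T Q^T m
    & diag_bounded (ff_d s) (ff_d shat) D m].

Lemma ff_step_bounded A L P U Q D j s shat :
  lower_Zfactor L P -> lower_Zfactor U^T Q^T -> (forall k, 0 < D 0 k) ->
  comparison_mx A = L *m diag_mx D *m U -> ff_bounded P Q D j s shat ->
  exists s' shat', [/\ ff_step tau A s j = Some s',
    ff_step tau (comparison_mx A) shat j = Some shat'
  & ff_bounded P Q D j.+1 s' shat'].
Proof.
move=> hL hU D0 E [hW hZ hd].
have hW' := ff_updW_bounded hL hU D0 E hW hZ hd.
have /andP[p1 p2] := ff_pivot_bounded hL hU E hW'.
(* Positivity of [D] excludes breakdown in both runs. *)
have p0 := lt_le_trans (D0 j) p1.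
rewrite /ff_step.
set W' := ff_updW tau A _ _ _ j in hW' p2 *.
set What' := ff_updW tau (comparison_mx A) _ _ _ j in hW' p0 p1 p2 *.
rewrite (gt_eqF p0) -normr_eq0 (gt_eqF (lt_le_trans p0 p2)).
do 2 eexists; split; [reflexivity | reflexivity |].
have hd' : diag_bounded (ff_updd (ff_d s) j (ff_pivot A W' j)^-1)
    (ff_updd (ff_d shat) j (ff_pivot (comparison_mx A) What' j)^-1) D j.+1.
  move=> i; rewrite ltnS leq_eqVlt !mxE.
  case/predU1P => [/val_inj ->|ij]; first by rewrite eqxx !invrK.
  by rewrite -val_eqE ltn_eqF //; apply: hd.
split=> //=; rewrite !ff_updZ_tr -comparison_mx_tr.
have E' : comparison_mx A^T = U^T *m diag_mx D *m L^T.
  by rewrite comparison_mx_tr; apply: LDU_tr.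
(* The [Z] update reads the new [W] and [d], but only their parts below index [j], so the bounds are
   weakened from [j.+1] to [j]. *)
apply: (@ff_updW_bounded A^T U^T Q^T L^T P^T D) => //; rewrite ?trmxK //.
- by move=> r i /andP[ir rj]; apply: hW'; rewrite ir ltnW.
- by move=> i ij; apply: hd'; rewrite ltnW.
Qed.

Lemma ffapinv_bounded A L P U Q D :
  lower_Zfactor L P -> lower_Zfactor U^T Q^T -> (forall k, 0 < D 0 k) ->
  comparison_mx A = L *m diag_mx D *m U ->
  exists s shat, [/\ ffapinv tau A = Some s,
    ffapinv tau (comparison_mx A) = Some shat & ff_bounded P Q D n s shat].
Proof.
move=> hL hU D0 E; rewrite /ffapinv.
(* Induction on the length [m] of the processed prefix of the index list. *)
suff H m : (m <= n)%N -> exists s shat, [/\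
    foldl (fun os j => obind (fun s => ff_step tau A s j) os)
      (Some (FFState 1%:M 1%:M 0)) (take m (enum 'I_n)) = Some s,
    foldl (fun os j => obind (fun s => ff_step tau (comparison_mx A) s j) os)
      (Some (FFState 1%:M 1%:M 0)) (take m (enum 'I_n)) = Some shat
  & ff_bounded P Q D m s shat].
  have := H n (leqnn n); rewrite take_oversize ?size_enum_ord //.
elim: m => [_|m IHm mn].
  (* Before the first step all bounds are vacuous. *)
  rewrite take0; do 2 eexists; split; [reflexivity | reflexivity |].
  by split=> [r i|r i|i] //; rewrite ltn0 andbF.
have [s [shat [e1 e2 hb]]] := IHm (ltnW mn).
have [s' [shat' [s1 s2 hb']]] :=
  ff_step_bounded (j := Ordinal mn) hL hU D0 E hb.
exists s', shat'.
rewrite (take_nth (Ordinal mn)) ?size_enum_ord // !foldl_rcons e1 e2 /=.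
by rewrite (_ : nth _ _ _ = Ordinal mn) //; apply: val_inj; rewrite /= nth_enum_ord.
Qed.

End Comparison.

Theorem theorem3 (R : realType) (n : nat) (A : 'M[R]_n) (tau : R)
    (HA : H_matrix A) (tau_gt0 : 0 < tau) :
  exists s shat : ff_state R n,
    [/\ ffapinv tau A = Some s,
        ffapinv tau (comparison_mx A) = Some shat
      & forall i : 'I_n,
          1 / ff_d shat 0 i <= `|1 / ff_d s 0 i| /\ 0 < 1 / ff_d shat 0 i].
Proof.
have [L [P [U [Q [D [hL hU D0 E]]]]]] := M_matrix_LDU HA.
have [s [shat [e1 e2 [_ _ hd]]]] := ffapinv_bounded tau hL hU D0 E.
exists s, shat; split=> // i; rewrite !div1r.
by have [h1 h2] := hd i (ltn_ord i); rewrite h2 (lt_le_trans (D0 i) h1).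
Qed.
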